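(* Let $G$ be a locally compact, second countable, amenable (Hausdorff) topological group that is not compact, let $\Phi$ be any left Følner sequence in $G$, and let $\varepsilon>0$. Then there is a closed subset $Q$ of $G$ with $\underline{\mathrm{d}}_\Phi(Q) > 1-\varepsilon$ that is not piecewise syndetic.
   Context: Fix a left Haar measure $\mathrm{m}$ on $G$. A left Følner sequence is a sequence $N\mapsto\Phi_N$ of compact, positive-measure subsets of $G$ such that $\lim_{N\to\infty}\mathrm{m}(\Phi_N\cap g\Phi_N)/\mathrm{m}(\Phi_N)=1$ uniformly for $g$ in compact subsets of $G$. For measurable $E\subset G$, the lower density with respect to $\Phi$ is $\underline{\mathrm{d}}_\Phi(E)=\liminf_{N\to\infty}\mathrm{m}(E\cap\Phi_N)/\mathrm{m}(\Phi_N)$. A subset $T$ of $G$ is thick if for every compact set $K\subset G$ there exists $g\in G$ with $Kg\subset T$. A subset $P$ of $G$ is piecewise syndetic if there exists a compact set $K\subset G$ such that $KP$ is thick. *)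

(* Defs.v *)
From HB Require Import structures.
From mathcomp Require Import all_boot all_order all_algebra.
From mathcomp Require Import all_classical all_reals all_analysis.

Set Implicit Arguments.
Unset Strict Implicit.
Unset Printing Implicit Defensive.

Import Order.TTheory GRing.Theory Num.Theory.
Import numFieldNormedType.Exports.

Local Open Scope classical_set_scope.
Local Open Scope ring_scope.

HB.mixin Record isTopologicalGroup G & Topological G & Group G := {
  mulg_continuous : continuous (fun x : G * G => (x.1 * x.2)%g) ;
  invg_continuous : continuous (fun x : G => (x^-1)%g)
}.

#[short(type="topologicalGroupType")]
HB.structure Definition TopologicalGroup :=
  {G of Topological G & Group G & isTopologicalGroup G}.

(* Measurable types must be pointed in MathComp-Analysis; a group is pointed
   by its identity. This alias of G carries that point. *)
Definition pointed_group (G : topologicalGroupType) : Type := G.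
HB.instance Definition _ (G : topologicalGroupType) :=
  Choice.on (pointed_group G).
HB.instance Definition _ (G : topologicalGroupType) :=
  isPointed.Build (pointed_group G) (1%g : G).

(* G with its Borel sigma-algebra. *)
Notation borel G :=
  (g_sigma_algebraType (@open G : set (set (pointed_group G)))).

Section TopologicalGroupDefs.
Context {G : topologicalGroupType}.
Implicit Types (A B K P T : set G) (g : G).

Definition left_translate g A : set G := [set (g * x)%g | x in A].

Definition right_translate A g : set G := [set (x * g)%g | x in A].

Definition set_mulg A B : set G := [set (x * y)%g | x in A & y in B].

Definition thick T := forall K, compact K ->
  exists g, right_translate K g `<=` T.

Definition piecewise_syndetic P := exists2 K, compact K & thick (set_mulg K P).

Context {R : realType}.
Implicit Types (m : {measure set (borel G) -> \bar R}) (Phi : nat -> set G).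

Record left_haar_measure m : Prop := {
  haar_neq0 : m [set: G] != 0%E ;
  haar_compact_fin : forall K, compact K -> (m K < +oo)%E ;
  haar_outer_regular : forall A, measurable (A : set (borel G)) ->
    m A = ereal_inf [set m U | U in [set U : set G | open U /\ A `<=` U]] ;
  haar_inner_regular : forall U : set G, open U ->
    m U = ereal_sup [set m K | K in [set K : set G | compact K /\ K `<=` U]] ;
  haar_left_invariant : forall g A, measurable (A : set (borel G)) ->
    m (left_translate g A) = m A
}.

(* M is a left-invariant mean on L^oo(G, m), given by its values on
   representatives; it is arbitrary outside [Lfun m +oo]. *)
Record left_invariant_mean m (M : (borel G -> R) -> R) : Prop := {
  mean_ae_eq : forall f h : borel G -> R,
    f \in Lfun m +oo%E -> h \in Lfun m +oo%E -> f = h %[ae m] -> M f = M h ;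
  mean_linear : forall (a : R) (f h : borel G -> R),
    f \in Lfun m +oo%E -> h \in Lfun m +oo%E ->
    M (fun x => a * f x + h x) = a * M f + M h ;
  mean_ge0 : forall f : borel G -> R, f \in Lfun m +oo%E ->
    (\forall x \ae m, 0 <= f x) -> 0 <= M f ;
  mean_one : M (fun=> 1) = 1 ;
  mean_left_invariant : forall g (f : borel G -> R), f \in Lfun m +oo%E ->
    M (fun x : G => f (g * x)%g) = M f
}.

(* Haar measures are unique up to scaling, so for a left Haar measure m this
   is a property of G alone. *)
Definition amenable m := exists M, left_invariant_mean m M.

(* m(A `&` B) / m(B), used when B is compact of positive measure. *)
Definition relative_measure m A B : R := fine (m (A `&` B)) / fine (m B).

Record left_folner_sequence m Phi : Prop := {
  folner_compact : forall N, compact (Phi N) ;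
  folner_gt0 : forall N, (0 < m (Phi N))%E ;
  folner_cvg : forall K, compact K ->
    {uniform K, (fun N g =>
        relative_measure m (left_translate g (Phi N)) (Phi N) : R) @ \oo
      --> (fun=> 1 : R)}
}.

Definition lower_density m Phi A : \bar R :=
  limn_einf (fun N => (relative_measure m A (Phi N))%:E).

End TopologicalGroupDefs.

(* Main.v *)
(* The complement of Q is a union of open sets V_n T_n, where the V_n are
   relatively compact, open and exhaust G, and T_n is left syndetic, i.e.
   L_n^-1 T_n = G with L_n compact. Every K^-1 lies in some V_n, so K Q contains
   no translate L_n g and Q is not piecewise syndetic.

   To make V T thin, fix f_1, ..., f_M whose translates f_i V are disjoint (G is
   not compact), put F = {1} `|` \bigcup_i f_i V and take T maximal such that the
   F t are disjoint: then F^-1 F T = G. The M sets f_i V T are disjoint and, by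
   the Folner property, have about the same density as V T along Phi, so V T has
   density at most 2 / M in Phi_N as soon as N >= N_0.

   Densities are not countably subadditive, but relative measures in each single
   Phi_N are. As N_0 depends on the f_i only and not on T, one may moreover ask T
   to avoid V^-1 Phi_N for N < N_0, so that the bound on the relative measure of
   V T holds for all N and can be summed over n. *)
Require Import Defs.
From mathcomp Require Import all_boot all_order all_algebra.
From mathcomp Require Import all_classical all_reals all_analysis.
From mathcomp Require Import lra.
Import Order.TTheory GRing.Theory Num.Theory.
Import numFieldNormedType.Exports.

Set Implicit Arguments.
Unset Strict Implicit.

Local Open Scope classical_set_scope.
Local Open Scope ring_scope.

(** * Translates, products and exhaustions in a topological group *)

Section TopologicalGroup.
Context {G : topologicalGroupType}.
Implicit Types (A B K L T U V : set G) (g h x : G).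

Lemma left_translateE g A : left_translate g A = [set x | A (g^-1 * x)%g].
Proof.
apply/seteqP; split=> x /= => [[y Ay <-]|Agx]; first by rewrite mulKg.
by exists (g^-1 * x)%g => //; rewrite mulVKg.
Qed.

Lemma left_translateI g A B :
  left_translate g (A `&` B) = left_translate g A `&` left_translate g B.
Proof. by rewrite !left_translateE. Qed.

Lemma left_translate_mul g A T :
  left_translate g (set_mulg A T) = set_mulg (left_translate g A) T.
Proof.
apply/seteqP; split=> [_ [_ [a Aa [t Tt <-]] <-]|_ [_ [a Aa <-] [t Tt <-]]].
  by exists (g * a)%g; [exists a|exists t => //; rewrite mulgA].
by exists (a * t)%g; [exists a => //; exists t|rewrite mulgA].
Qed.

Lemma mulgl_continuous g : continuous (fun x : G => (g * x)%g).
Proof.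
move=> x; apply: (continuous2_cvg _ (mulg_continuous (g, x))) => //=.
exact: cvg_cst.
Qed.

Lemma mulgr_continuous g : continuous (fun x : G => (x * g)%g).
Proof.
move=> x; apply: (continuous2_cvg _ (mulg_continuous (x, g))) => //=.
exact: cvg_cst.
Qed.

Lemma open_left_translate g U : open U -> open (left_translate g U).
Proof.
rewrite left_translateE => oU.
by apply: open_comp => // x _; exact: mulgl_continuous.
Qed.

Lemma compact_left_translate g K : compact K -> compact (left_translate g K).
Proof.
apply: continuous_compact; apply: continuous_subspaceT; exact: mulgl_continuous.
Qed.

Lemma open_set_mulg U T : open U -> open (set_mulg U T).
Proof.
move=> oU; rewrite (_ : set_mulg U T =
    \bigcup_(t in T) [set x | U (x * t^-1)%g]).
  apply: bigcup_open => t _.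
  by apply: open_comp => // x _; exact: mulgr_continuous.
apply/seteqP; split=> [_ [u Uu [t Tt <-]]|x [t Tt Uxt]].
  by exists t => //=; rewrite mulgK.
by exists (x * t^-1)%g => //; exists t => //; rewrite mulgVK.
Qed.

Lemma compact_set_mulg K L : compact K -> compact L -> compact (set_mulg K L).
Proof.
move=> cK cL; rewrite (_ : set_mulg K L =
    [set (x.1 * x.2)%g | x in K `*` L]).
  apply: continuous_compact (compact_setX cK cL).
  by apply: continuous_subspaceT; exact: mulg_continuous.
apply/seteqP; split=> [_ [x Kx [y Ly <-]]|_ [[x y] /= [Kx Ly] <-]].
  by exists (x, y).
by exists x => //; exists y.
Qed.

Lemma compact_set_invg K : compact K -> compact [set (x^-1)%g | x in K].
Proof.
apply: continuous_compact; apply: continuous_subspaceT; exact: invg_continuous.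
Qed.

Lemma compactU A B : compact A -> compact B -> compact (A `|` B).
Proof.
move=> cA cB; rewrite -bigcup2inE bigcup_mkord.
by apply: bigsetU_compact => -[[|[|//]] ?] _ /=.
Qed.

Lemma compact_bigcup_ord n (K : nat -> set G) :
  (forall i, compact (K i)) -> compact (\bigcup_(i < n) K i).
Proof.
by move=> cK; rewrite bigcup_mkord; apply: bigsetU_compact.
Qed.

Lemma not_compact_ex_notin K : ~ compact [set: G] -> compact K ->
  exists x, ~ K x.
Proof.
move=> ncG cK; apply: contrapT => /forallNP nK; apply: ncG.
by rewrite (_ : setT = K) //; apply/seteqP; split=> // x _; exact: contrapT.
Qed.

(** By induction on [M]: a new translate [g K] meets some earlier [f i K] only if [g] lies in the
    compact set [D], the union of the [f i K] times the inverse of [K]. Noncompactness provides a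
    [g] outside [D]. *)
Lemma exists_disjoint_translates M K : ~ compact [set: G] -> compact K ->
  exists f : nat -> G,
    trivIset [set i | (i < M)%N] (fun i => left_translate (f i) K).
Proof.
move=> ncG cK; elim: M => [|M [f tf]].
  by exists (fun=> 1%g) => i j.
pose D := set_mulg (\bigcup_(i < M) left_translate (f i) K)
                   [set (x^-1)%g | x in K].
have cD : compact D.
  apply: compact_set_mulg; last exact: compact_set_invg.
  by apply: compact_bigcup_ord => i; exact: compact_left_translate.
have [g nDg] := not_compact_ex_notin ncG cD.
have dsj i x : (i < M)%N -> left_translate (f i) K x ->
    left_translate g K x -> False.
  move=> iM fKx [k Kk gkx]; apply: nDg; exists x; first by exists i.
  by exists (k^-1)%g; [exists k|rewrite -gkx mulgK].
exists (fun i => if (i < M)%N then f i else g) => i j /=.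
rewrite !ltnS (leq_eqVlt i) (leq_eqVlt j) => /orP[/eqP->|iM] /orP[/eqP->|jM] //.
- by rewrite ltnn jM => -[x [gx fx]]; case: (dsj j x).
- by rewrite ltnn iM => -[x [fx gx]]; case: (dsj i x).
- by rewrite iM jM; exact: tf.
Qed.

(** [V n] collects those among the first [n] sets of an enumerated base that lie in a compact set,
    and [C n] collects the corresponding compact sets. *)
Lemma open_exhaustion : locally_compact [set: G] -> @second_countable G ->
  exists V C : nat -> set G,
    [/\ forall n, open (V n), forall n, compact (C n),
        forall n, V n `<=` C n
      & forall K, compact K -> exists n, K `<=` V n].
Proof.
move=> lcG [B cB [oB basisB]].
have [f fB] : exists f : nat -> set G, forall U, B U -> exists n, f n = U.
  have [f fB] := pcard_surjP cB.
  by exists f => U /fB[n _ <-]; exists n.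
(* Indices without a relatively compact basic set get the empty pair, so that [F] below is total. *)
have W n : exists WC : set G * set G, [/\ open WC.1, compact WC.2,
    WC.1 `<=` WC.2 &
    forall C, B (f n) -> compact C -> f n `<=` C -> WC.1 = f n].
  have [[Bf [C [cC fC]]]|nB] :=
    pselect (B (f n) /\ exists C, compact C /\ f n `<=` C).
    by exists (f n, C); split => //=; exact: oB.
  exists (set0, set0); split => //=; first exact: open0.
    exact: compact0.
  by move=> C Bf cC fC; case: nB; split => //; exists C.
have [F hF] := choice W.
exists (fun n => \bigcup_(i < n) (F i).1), (fun n => \bigcup_(i < n) (F i).2).
split=> [n|n|n x [i ? Fx]|K /compact_near_coveringP ncK].
- by apply: bigcup_open => i _; have [] := hF i.
- by apply: compact_bigcup_ord => i; have [] := hF i.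
- by exists i => //; have [_ _ + _] := hF i; apply.
(* Compactness in its near covering form: each point of [K] has a neighborhood contained in all
   [V k] with [k] large, hence so is [K] itself. *)
have /= := ncK nat \oo (fun n => \bigcup_(i < n) (F i).1) _ _.
case=> // [x _|n _ Kn]; last by exists n; apply: Kn => /=.
have [C nC [cC clC]] := lcG x I.
have [U [BU Ux] UC] : filter_from [set U | B U /\ U x] id C.
  apply: basisB; move: nC; rewrite /within /=.
  by apply: filterS => y /(_ I).
have [n fnU] := fB U BU.
have FnU : (F n).1 = U.
  by have [_ _ _] := hF n; rewrite fnU; apply; eauto.
exists (U, [set k | (n < k)%N]) => /=.
  split; first by apply: open_nbhs_nbhs; split => //; exact: oB.
  by exists n.+1.
by move=> [y k] /= [Uy nk]; exists n => //; rewrite FnU.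
Qed.

End TopologicalGroup.

(** * Borel sets and relative measures in a fixed compact set *)

Lemma borel_open (G : topologicalGroupType) (U : set G) :
  open U -> measurable (U : set (borel G)).
Proof. by move=> oU; apply: sub_sigma_algebra. Qed.

Lemma borel_closed (G : topologicalGroupType) (A : set G) :
  closed A -> measurable (A : set (borel G)).
Proof.
move=> cA; rewrite -[A]setCK; apply: measurableC.
by apply: borel_open; exact: closed_openC.
Qed.

Section RelativeMeasure.
Context {R : realType} {G : topologicalGroupType}.
Context {m : {measure set (borel G) -> \bar R}} {P : set G}.
Context (hausdorffG : hausdorff_space G) (haar_m : left_haar_measure m).
Context (compactP : compact P) (mP_gt0 : (0 < m P)%E).
Implicit Types A B : set (borel G).

Local Notation r A := (relative_measure m A P).

Let mP : measurable (P : set (borel G)).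
Proof. by apply: borel_closed; exact: compact_closed. Qed.

Let mP_fin : m P \is a fin_num.
Proof. by rewrite ge0_fin_numE//; exact: (haar_compact_fin haar_m). Qed.

Let fine_mP_gt0 : 0 < fine (m P).
Proof. by rewrite fine_gt0// mP_gt0 -ge0_fin_numE. Qed.

Let mI_fin A : measurable A -> m (A `&` P) \is a fin_num.
Proof.
move=> mA; rewrite ge0_fin_numE//; apply: le_lt_trans (measureIr m mA mP) _.
exact: (haar_compact_fin haar_m).
Qed.

Lemma relative_measure0 : r set0 = 0.
Proof. by rewrite /relative_measure set0I measure0 mul0r. Qed.

Lemma relative_measureT : r setT = 1.
Proof. by rewrite /relative_measure setTI divff// gt_eqF. Qed.

Lemma le_relative_measure A B :
  measurable A -> measurable B -> A `<=` B -> r A <= r B.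
Proof.
move=> mA mB AB; rewrite ler_pM2r ?invr_gt0// fine_le ?mI_fin//.
by apply: le_measure; rewrite ?inE; [exact: measurableI..|exact: setSI].
Qed.

Lemma relative_measureU A B : measurable A -> measurable B ->
  A `&` B = set0 -> r (A `|` B) = r A + r B.
Proof.
move=> mA mB AB0; rewrite /relative_measure setIUl measureU.
- by rewrite fineD ?mI_fin// mulrDl.
- exact: measurableI.
- exact: measurableI.
- by rewrite setIACA AB0 set0I.
Qed.

Lemma relative_measureC A : measurable A -> r (~` A) = 1 - r A.
Proof.
move=> mA; apply/eqP; rewrite eq_sym subr_eq addrC.
rewrite -relative_measureU ?setUv ?relative_measureT ?setICr//.
exact: measurableC.
Qed.

Lemma sum_relative_measure_le1 (M : nat) (F : nat -> set (borel G)) :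
  (forall i, measurable (F i)) -> trivIset [set i | (i < M)%N] F ->
  \sum_(i < M) r (F i) <= 1.
Proof.
move=> mF tF; suff H n : (n <= M)%N ->
    \sum_(i < n) r (F i) = r (\bigcup_(i < n) F i).
  rewrite H// -relative_measureT; apply: le_relative_measure => //.
  exact: bigcup_measurable.
elim: n => [|n IH] nM.
  by rewrite big_ord0 bigcup_mkord big_ord0 relative_measure0.
rewrite big_ord_recr/= IH 1?ltnW// [in RHS]bigcup_mkord.
rewrite big_ord_recr/= -bigcup_mkord.
rewrite relative_measureU//; first exact: bigcup_measurable.
rewrite -subset0 => x [[i /= ni Fix] Fnx].
have /eqP := tF i n (ltn_trans ni nM) nM (ex_intro _ x (conj Fix Fnx)).
by rewrite ltn_eqF.
Qed.

Lemma relative_measure_sigma_subadditive (F : nat -> set (borel G)) (eps : R) :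
  0 <= eps -> (forall n, measurable (F n)) ->
  (forall n, r (F n) <= eps / (2 ^ n.+1)%:R) -> r (\bigcup_n F n) <= eps.
Proof.
move=> e0 mF rF; have mU : measurable (\bigcup_n F n).
  exact: bigcup_measurable.
rewrite /relative_measure ler_pdivrMr// -lee_fin fineK ?mI_fin//.
apply: (@le_trans _ _ (\sum_(0 <= n <oo) m (F n `&` P))%E).
  apply: measure_sigma_subadditive => [n||]; try exact: measurableI.
  by rewrite setI_bigcupl.
apply: le_trans (epsilon_trick0 xpredT _); last by rewrite mulr_ge0// ltW.
apply: lee_nneseries => // n _.
rewrite -(fineK (mI_fin (mF n))) lee_fin mulrAC -ler_pdivrMr//.
exact: rF.
Qed.

(** By left invariance, the part of [U] in both [P] and [C] has the measure of its translate by [g],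
    which lies in both [left_translate g U] and [P]. The rest of [U] in [P] lies outside [C], which
    costs at most [1 - r C]. *)
Lemma relative_measure_left_translate g (U : set G) : open U ->
  r U + r (left_translate g^-1%g P) - 1 <= r (left_translate g U).
Proof.
move=> oU; pose C := left_translate g^-1%g P.
have mC : measurable (C : set (borel G)).
  apply: borel_closed; apply: compact_closed => //.
  exact: compact_left_translate.
have mU : measurable (U : set (borel G)) by exact: borel_open.
have mgU : measurable (left_translate g U : set (borel G)).
  by apply: borel_open; exact: open_left_translate.
have mUC : measurable (U `&` C : set (borel G)) by exact: measurableI.
have gC : left_translate g C = P.
  by rewrite /C !left_translateE; apply/seteqP; split=> x /=;
    rewrite invgK mulVKg.
have rUC : r (U `&` C) <= r (left_translate g U).
  rewrite ler_pM2r ?invr_gt0// fine_le ?mI_fin//.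
  rewrite -(haar_left_invariant haar_m g); last exact: measurableI.
  rewrite !left_translateI gC -setIA.
  have mgP : measurable (left_translate g P : set (borel G)).
    apply: borel_closed; apply: compact_closed => //.
    exact: compact_left_translate.
  apply: le_measure; rewrite ?inE; [|exact: measurableI|].
    by apply: measurableI => //; exact: measurableI.
  by rewrite setIA; exact: subIsetl.
have : r U <= r (U `&` C) + r (~` C).
  rewrite -relative_measureU//; [|exact: measurableC|].
    apply: le_relative_measure => //.
      by apply: measurableU => //; exact: measurableC.
    by move=> x Ux; have [Cx|nCx] := pselect (C x); [left|right].
  by rewrite -setIA setICr setI0.
rewrite relative_measureC//.
by move: rUC; rewrite -/C; lra.
Qed.

(** Each translate keeps relative measure at least [r U - 1 / M], and [M] disjoint ones total at
    most 1; hence [M * r U - 1 <= 1]. *)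
Lemma relative_measure_disjoint_translates (M : nat) (f : nat -> G)
    (U : set G) : (0 < M)%N -> open U ->
  trivIset [set i | (i < M)%N] (fun i => left_translate (f i) U) ->
  (forall i, (i < M)%N -> 1 - M%:R^-1 <= r (left_translate (f i)^-1%g P)) ->
  r U <= 2 / M%:R.
Proof.
move=> M0 oU tU rP.
have M0R : 0 < M%:R :> R by rewrite ltr0n.
have mU i : measurable (left_translate (f i) U : set (borel G)).
  by apply: borel_open; exact: open_left_translate.
have := sum_relative_measure_le1 mU tU.
have : \sum_(i < M) (r U - M%:R^-1) <=
       \sum_(i < M) r (left_translate (f i) U).
  apply: ler_sum => i _.
  apply: le_trans (relative_measure_left_translate (f i) oU).
  by have := rP i (ltn_ord i); lra.
rewrite sumr_const card_ord -[_ *+ M]mulr_natr => h1 h2.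
rewrite ler_pdivlMr//; move: (le_trans h1 h2).
rewrite mulrBl mulVf ?gt_eqF//; lra.
Qed.

End RelativeMeasure.

(** * Maximal packings and syndeticity *)

(** The translates [F t], for distinct [t] in [T], are disjoint. *)
Definition packing (G : topologicalGroupType) (F T : set G) :=
  forall a b s t, F a -> F b -> T s -> T t -> (a * s = b * t)%g -> s = t.

(** Zorn's lemma applies since two points of the union of a chain lie in a common member. If [g] in
    [S] cannot be added to a maximal [T], then [F g] meets some [F t]. *)
Lemma exists_maximal_packing (G : topologicalGroupType) (F S : set G) :
  F !=set0 -> exists T, [/\ T `<=` S, packing F T &
    forall g, S g -> exists a b t,
      [/\ F a, F b, T t & (a * g = b * t)%g]].
Proof.
move=> [c Fc].
have [] := @Zorn_bigcup _ [set T | T `<=` S /\ packing F T].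
  move=> X XP tX; split=> [|a b s t Fa Fb [A XA As] [B XB Bt]].
    by apply: bigcup_sub => A /XP[].
  have [AB|BA] := tX A B XA XB.
    by apply: (XP B XB).2 => //; exact: AB.
  by apply: (XP A XA).2 => //; exact: BA.
move=> T [[TS pT] maxT]; exists T; split=> // g Sg.
have [Tg|nTg] := pselect (T g); first by exists c, c, g.
apply: contrapT => ng; apply: (maxT (T `|` [set g])).
  split; last by move=> /(_ g (or_intror erefl)).
  by move=> x Tx; left.
split=> [x [/TS//|->//]|a b s t Fa Fb [Ts|->] [Tt|->] // abst].
- exact: pT abst.
- by case: ng; exists b, a, s.
- by case: ng; exists a, b, t.
Qed.

Lemma exists_syndetic_packing (G : topologicalGroupType) (F D : set G) :
  ~ compact [set: G] -> compact F -> F !=set0 -> compact D ->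
  exists T L, [/\ T `<=` ~` D, packing F T, compact L &
    forall g, exists2 l, L l & T (l * g)%g].
Proof.
move=> ncG cF F0 cD.
have [T [TD pT mT]] := exists_maximal_packing (~` D) F0.
have cD1 := compact_set_invg cD; have cF1 := compact_set_invg cF.
(* If [g] and [h g] were both in [D], then [h] would be in [D D^-1]. So one of [g], [h g] avoids
   [D], and [L = F^-1 F {1, h}] works for every [g], although [T] is maximal only outside [D]. *)
have [h hD] := not_compact_ex_notin ncG (compact_set_mulg cD cD1).
exists T, (set_mulg (set_mulg [set (x^-1)%g | x in F] F)
                    ([set 1%g] `|` [set h])).
split=> // [|g].
  apply: compact_set_mulg; first exact: compact_set_mulg.
  by apply: compactU; exact: compact_set1.
have [k hk nDkg] : exists2 k, ([set 1%g] `|` [set h]) k & ~ D (k * g)%g.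
  have [Dg|nDg] := pselect (D g); last by exists 1%g; [left|rewrite mul1g].
  exists h; [by right|move=> Dhg; apply: hD].
  by exists (h * g)%g => //; exists (g^-1)%g; [exists g|rewrite mulgK].
have [a [b [t [Fa Fb Tt abt]]]] := mT _ nDkg.
exists ((b^-1 * a) * k)%g.
  exists (b^-1 * a)%g; last by exists k.
  by exists (b^-1)%g; [exists b|exists a].
by rewrite -!mulgA abt mulKg.
Qed.

(** * Thin syndetic sets along a Følner sequence *)

Lemma exists_thin_syndetic (R : realType) (G : topologicalGroupType)
    (m : {measure set (borel G) -> \bar R}) (Phi : nat -> set G)
    (V K : set G) (delta : R) :
  hausdorff_space G -> ~ compact [set: G] -> left_haar_measure m ->
  left_folner_sequence m Phi -> open V -> compact K -> V `<=` K ->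
  0 < delta ->
  exists T L, [/\ compact L, forall g, exists2 l, L l & T (l * g)%g &
    forall N, relative_measure m (set_mulg V T) (Phi N) <= delta].
Proof.
move=> hG ncG haar_m folner oV cK VK d0.
have [M M0 Md] : exists2 M, (0 < M)%N & 2 / M%:R <= delta.
  have d2 : 0 < 2 / delta by rewrite divr_gt0.
  exists (Num.bound (2 / delta)).
    by rewrite -(ltr_nat R); apply: lt_trans (archi_boundP (ltW d2)).
  have b0 := lt_trans d2 (archi_boundP (ltW d2)).
  rewrite ler_pdivrMr// mulrC -ler_pdivrMr//.
  exact: ltW (archi_boundP (ltW d2)).
have [f tf] := exists_disjoint_translates M ncG cK.
(* The Følner condition is used on the singletons [(f i)^-1] only; [N0] is common to the finitely
   many [i] and is fixed before [T]. *)
have [N0 _ N0P] : \forall N \near \oo, forall i : 'I_M, 1 - M%:R^-1 <=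
    relative_measure m (left_translate (f i)^-1%g (Phi N)) (Phi N).
  apply: filter_forall => i.
  have := folner_cvg folner (@compact_set1 G (f i)^-1%g).
  rewrite uniform_set1 => /cvgr_ge; apply.
  by rewrite ltrBlDr ltrDl invr_gt0 ltr0n.
pose C := \bigcup_(N < N0) Phi N.
(* If [v t] is in [Phi N] with [v] in [V] and [N < N0], then [t] is in [D]; a [T] avoiding [D] thus
   gives relative measure 0 there. *)
pose D := set_mulg [set (x^-1)%g | x in K] C.
(* [K] replaces [V] to make [F] compact; the point 1 keeps [F] nonempty even if [K] is empty. *)
pose F := [set 1%g] `|` \bigcup_(i < M) left_translate (f i) K.
have cF : compact F.
  apply: compactU; first exact: compact_set1.
  by apply: compact_bigcup_ord => i; exact: compact_left_translate.
have cD : compact D.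
  apply: compact_set_mulg; first exact: compact_set_invg.
  apply: compact_bigcup_ord => N; exact: (folner_compact folner).
have F0 : F !=set0 by exists 1%g; left.
have [T [L [TD pT cL hL]]] := exists_syndetic_packing ncG cF F0 cD.
exists T, L; split=> // N; have [N0N|NN0] := leqP N0 N; last first.
  rewrite /relative_measure (_ : _ `&` _ = set0); last first.
    rewrite -subset0 => _ [[v Vv [t Tt <-]] Pvt].
    apply: TD Tt _; exists (v^-1)%g; first by exists v => //; exact: VK.
    by exists (v * t)%g; [exists N|rewrite mulKg].
  by rewrite measure0 mul0r ltW.
apply: le_trans Md.
apply: (relative_measure_disjoint_translates hG haar_m
  (folner_compact folner (N := N)) (folner_gt0 folner N) (f := f)) => //.
- exact: open_set_mulg.
- move=> i j iM jM /=; rewrite !left_translate_mul.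
  move=> [_ [[_ [v Vv <-] [t Tt <-]] [_ [w Vw <-] [s Ts fvwst]]]].
  have Fv : F (f i * v)%g by right; exists i => //; exists v => //; exact: VK.
  have Fw : F (f j * w)%g by right; exists j => //; exists w => //; exact: VK.
  (* A common point of two translates of [V T] has the same [T] factor in both by packing;
     cancelling it yields a common point of [f i K] and [f j K], so [i = j]. *)
  have st : s = t by exact: pT fvwst.
  apply: tf => //; exists (f i * v)%g; split; first by exists v => //; exact: VK.
  exists w; first exact: VK.
  by move: fvwst; rewrite st => /mulIg.
- by move=> i iM; exact: (N0P N N0N (Ordinal iM)).
Qed.

(** * Construction of the closed set *)

Theorem theorem1p9 (R : realType) (G : topologicalGroupType)
    (m : {measure set (borel G) -> \bar R}) (Phi : nat -> set G) (eps : R)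
    (hausdorffG : hausdorff_space G)
    (locally_compactG : locally_compact [set: G])
    (second_countableG : @second_countable G)
    (haar_m : left_haar_measure m)
    (amenableG : amenable m)
    (noncompactG : ~ compact [set: G])
    (folnerPhi : left_folner_sequence m Phi)
    (eps_gt0 : 0 < eps) :
  exists Q : set G,
    [/\ closed Q, ((1 - eps)%:E < lower_density m Phi Q)%E
      & ~ piecewise_syndetic Q].
Proof.
have [V [C [oV cC VC exV]]] := open_exhaustion locally_compactG second_countableG.
have e2 : 0 < eps / 2 by rewrite divr_gt0.
have de n : 0 < eps / 2 / (2 ^ n.+1)%:R by rewrite divr_gt0// ltr0n expn_gt0.
have /choice[T /choice[L TL]] := fun n => exists_thin_syndetic hausdorffG
  noncompactG haar_m folnerPhi (oV n) (cC n) (VC n) (de n).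
pose U := \bigcup_n set_mulg (V n) (T n).
have oVT n : open (set_mulg (V n) (T n)) by exact: open_set_mulg.
have oU : open U by apply: bigcup_open.
exists (~` U); split; first exact: open_closedC.
  (* The removed sets total at most [eps / 2], which leaves room for the strict inequality. *)
  apply: (@lt_le_trans _ _ (1 - eps / 2)%:E); first by rewrite lte_fin; lra.
  rewrite /lower_density limn_einf_lim; apply: lime_ge.
    exact: is_cvg_einfs.
  (* The bound holds in every [Phi N], so all tail infima satisfy it. *)
  apply: nearW => n; apply: le_ereal_inf_tmp => _ [N _ <-]; rewrite lee_fin.
  rewrite (relative_measureC hausdorffG haar_m (folner_compact folnerPhi (N := N))
    (folner_gt0 folnerPhi N)); last exact: borel_open.
  rewrite lerD2l lerN2.
  apply: (relative_measure_sigma_subadditive hausdorffG haar_m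
    (folner_compact folnerPhi (N := N)) (folner_gt0 folnerPhi N)) => [|k|k].
  - exact: ltW.
  - exact: borel_open.
  - by have [_ _] := TL k.
move=> [K cK thickKQ].
(* With [K^-1] inside [V n], thickness puts some [L n g] in [K Q]. A point [l g] of it is in [T n]
   and equals [k q], so [q = k^-1 (l g)] is in [V n T n], which [Q] omits. *)
have [n KV] := exV _ (compact_set_invg cK).
have [cL hL _] := TL n.
have [g Lg] := thickKQ _ cL.
have [l Ll Tlg] := hL g.
have [k Kk [q nUq kq]] : set_mulg K (~` U) (l * g)%g by apply: Lg; exists l.
apply: nUq; exists n => //; exists (k^-1)%g; first by apply: KV; exists k.
by exists (l * g)%g => //; rewrite -kq mulKg.
Qed.
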